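(* Let $n \ge 3$, let $D$ be a real symmetric $n\times n$ matrix with $D_{ij}=D_{ji}>0$ for $i\ne j$, and let $d=\lfloor n/2\rfloor$. Then the optimal value of the semidefinite program $$\min\ \tfrac12 \operatorname{trace}\left(DX^{(1)}\right)$$ over real symmetric $n\times n$ matrices $X^{(1)},\ldots,X^{(d)}$, subject to $$X^{(k)}\ge 0\ \ (k=1,\ldots,d),\qquad \sum_{k=1}^d X^{(k)}=J-I,\qquad I+\sum_{k=1}^d\cos\left(\frac{2\pi i k}{n}\right)X^{(k)}\succeq 0\ \ (i=1,\ldots,d),$$ is a lower bound on the optimal value $TSP_{opt}$ of the symmetric traveling salesman problem with edge length matrix $D$.
   Context: $I$ and $J$ denote the $n\times n$ identity and all-ones matrices. For a matrix $M$, $M\ge 0$ means entrywise nonnegativity, and $M\succeq 0$ means that $M$ is symmetric positive semidefinite. $K_n(D)$ is the complete graph on vertices $1,\ldots,n$ with edge lengths $D_{ij}$. $TSP_{opt}$ is the minimum total length of a Hamiltonian circuit in $K_n(D)$. Equivalently, $TSP_{opt}=\min_{X\in\Pi_n}\operatorname{trace}\left(\tfrac12 DXC_1X^T\right)$, where $\Pi_n$ is the set of $n\times n$ permutation matrices and $C_1$ is the adjacency matrix of the standard circuit on $n$ vertices (vertices $i$ and $j$ are adjacent if and only if $i-j\equiv\pm1 \pmod n$). *)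

(* Defs.v *)
From mathcomp Require Import all_boot all_order all_algebra.
From mathcomp Require Import classical_sets reals ereal trigo.

Set Implicit Arguments.
Unset Strict Implicit.
Unset Printing Implicit Defensive.

Import Order.TTheory GRing.Theory Num.Theory.
Local Open Scope classical_set_scope.
Local Open Scope ring_scope.

Definition mx_nonneg (R : realType) (n : nat) (M : 'M[R]_n) : Prop :=
  forall i j, 0 <= M i j.

Definition mx_psd (R : realType) (n : nat) (M : 'M[R]_n) : Prop :=
  M^T = M /\ forall v : 'cV[R]_n, 0 <= (v^T *m M *m v) 0 0.

(* The vertices 1, ..., n of the complete graph are the elements of 'I_n, and
   a Hamiltonian circuit is given by its vertices in order of visit: a
   duplicate-free sequence of length n visits every vertex exactly once. *)
Definition hamiltonian (n : nat) (c : n.-tuple 'I_n) : bool :=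
  ucycleb [rel i j : 'I_n | i != j] c.

Definition circuit_length (R : realType) (n : nat) (D : 'M[R]_n)
    (c : n.-tuple 'I_n) : R :=
  \sum_(i <- c) D i (next c i).

(* The circuit ord_tuple n = (0, ..., n-1) only witnesses that the minimum
   ranges over a nonempty set; it is Hamiltonian as soon as n >= 2. *)
Definition TSP_opt (R : realType) (n : nat) (D : 'M[R]_n) : R :=
  circuit_length D
    [arg min_(c < ord_tuple n | hamiltonian c) circuit_length D c]%O.

(* Here d = n./2, and the variables X^(1), ..., X^(d) are X 1, ..., X d; the
   values of X at other indices are unconstrained and occur nowhere. *)
Definition SDP_feasible (R : realType) (n : nat) (X : nat -> 'M[R]_n) : Prop :=
  [/\ forall k, (1 <= k <= n./2)%N -> (X k)^T = X k,
      forall k, (1 <= k <= n./2)%N -> mx_nonneg (X k),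
      \sum_(1 <= k < (n./2).+1) X k = const_mx 1 - 1%:M &
      forall i, (1 <= i <= n./2)%N ->
        mx_psd (1%:M + \sum_(1 <= k < (n./2).+1)
                         cos (2 * pi * i%:R * k%:R / n%:R) *: X k)].

(* The infimum is taken in the extended reals, so that it is +oo (and not an
   arbitrary default) should there be no feasible point. *)
Definition SDP_opt (R : realType) (n : nat) (D : 'M[R]_n) : \bar R :=
  ereal_inf [set (2^-1 * \tr (D *m X 1%N))%:E
            | X in [set X : nat -> 'M[R]_n | SDP_feasible X]].

(* Main.v *)
Require Import Defs.
From mathcomp Require Import all_boot all_order all_algebra.
From mathcomp Require Import reals ereal.
From mathcomp Require Import trigo zify ring.

Set Implicit Arguments.
Unset Strict Implicit.
Unset Printing Implicit Defensive.

Import Order.TTheory GRing.Theory Num.Theory.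
Local Open Scope ring_scope.

(** An optimal tour itself gives a feasible point of the semidefinite program
    whose objective value is the length of the tour; the infimum can then only
    be smaller.

    Relabel the vertices by their position along the tour, and let X^(k) be the
    0/1 matrix marking the pairs of vertices at cyclic distance exactly k along
    it (the distance classes of the n-cycle, [cycle_dist_mx]). Every pair of
    distinct vertices is at a unique distance between 1 and n/2, so the X^(k)
    add up to J - I. The matrix inequality numbered i holds because the cosine
    is even and 2 pi-periodic: the (a, b) entry of I + sum_k cos(2 pi i k/n)
    X^(k) is cos(t_a - t_b), where t_a is 2 pi i / n times the position of a
    ([cos_cycle_dist]), and such a matrix is the Gram matrix of the plane
    vectors (cos t_a, sin t_a) ([mx_psd_cos_sub]). Finally X^(1) is the
    adjacency matrix of the tour, so half the trace of D X^(1) counts every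
    tour edge once ([trace_cycle_dist_mx1]); this is where n >= 3 matters, as
    for n = 2 the two directions of an edge would coincide. *)

Definition cycle_dist (n p q : nat) : nat :=
  minn (maxn p q - minn p q) (n - (maxn p q - minn p q)).

Lemma cycle_distC n p q : cycle_dist n p q = cycle_dist n q p.
Proof. by rewrite /cycle_dist maxnC (minnC p q). Qed.

Lemma cycle_dist_le_half n p q : (cycle_dist n p q <= n./2)%N.
Proof. by rewrite /cycle_dist; lia. Qed.

Lemma cycle_dist_eq0 n p q : (p < n)%N -> (q < n)%N ->
  (cycle_dist n p q == 0)%N = (p == q).
Proof. by rewrite /cycle_dist; lia. Qed.

(** For n = 2 the successor and the predecessor of a position coincide, and
    the right-hand side would count it twice. *)
Lemma cycle_dist_eq1 n p q : (2 < n)%N -> (p < n)%N -> (q < n)%N ->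
  (cycle_dist n p q == 1)%N = ((q == p.+1 %% n) + (p == q.+1 %% n))%N :> nat.
Proof.
move=> n_gt2 p_lt q_lt.
have succ_mod r : (r < n)%N -> (r.+1 %% n = if r.+1 == n then 0 else r.+1)%N.
  move=> r_lt; case: eqP => [-> | /eqP r1_neq]; first by rewrite modnn.
  by rewrite modn_small // ltn_neqAle r1_neq.
rewrite !succ_mod // /cycle_dist.
by case: (p.+1 =P n); case: (q.+1 =P n); lia.
Qed.

(** Replacing the difference of the positions by its complement to n changes
    the angle by the i-th multiple of 2 pi. *)
Lemma cos_cycle_dist (R : realType) n i p q : (p < n)%N -> (q < n)%N ->
  cos (2 * pi * i%:R * (cycle_dist n p q)%:R / n%:R) =
  cos (2 * pi * i%:R / n%:R * p%:R - 2 * pi * i%:R / n%:R * q%:R) :> R.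
Proof.
wlog le_qp : p q / (q <= p)%N => [IH | p_lt q_lt].
  case: (leqP q p) => [/IH // | /ltnW /IH IHqp p_lt q_lt].
  by rewrite cycle_distC IHqp // -cosN opprB.
have n_neq0 : n%:R != 0 :> R by rewrite pnatr_eq0; lia.
have diffE : (maxn p q - minn p q = p - q)%N by lia.
rewrite -mulrBr -natrB // /cycle_dist diffE.
have [_ | _] := leqP (p - q) (n - (p - q)); first by congr cos; ring.
rewrite [in LHS]natrB; last by lia.
have -> : 2 * pi * i%:R * (n%:R - (p - q)%:R) / n%:R =
          - (2 * pi * i%:R / n%:R * (p - q)%:R) + pi *+ 2 *+ i :> R.
  by rewrite -mulr_natr -[pi *+ 2]mulr_natr; field.
by rewrite (periodicn (@cosD2pi R)) cosN.
Qed.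

(** By the subtraction formula for the cosine, the quadratic form is the squared
    length of the combination of the vectors (cos t_a, sin t_a) with weights
    v_a. *)
Lemma mx_psd_cos_sub (R : realType) n (t : 'I_n -> R) :
  mx_psd (\matrix_(a, b) cos (t a - t b)).
Proof.
split=> [|v]; first by apply/matrixP=> a b; rewrite !mxE -cosN opprB.
pose x := \sum_a v a 0 * cos (t a); pose y := \sum_a v a 0 * sin (t a).
suff -> : (v^T *m (\matrix_(a, b) cos (t a - t b)) *m v) 0 0 = x ^+ 2 + y ^+ 2.
  by rewrite addr_ge0 ?sqr_ge0.
rewrite mxE !expr2 !mulr_sumr -big_split /=; apply: eq_bigr => b _.
rewrite mxE !mulr_suml -big_split /=; apply: eq_bigr => a _.
by rewrite !mxE cosB; ring.
Qed.

Lemma index_next (T : eqType) (c : seq T) x : uniq c -> x \in c ->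
  index (next c x) c = ((index x c).+1 %% size c)%N.
Proof.
case: c => [|y c] // c_uniq x_c; rewrite next_nth x_c.
have idx_le : (index x (y :: c) <= size c)%N by rewrite -ltnS index_mem.
case: (ltngtP (index x (y :: c)) (size c)) idx_le => // [idx_lt | idx_eq] _.
  by rewrite -[nth _ _ _]/(nth y (y :: c) (index x (y :: c)).+1) index_uniq //
             modn_small.
by rewrite idx_eq nth_default // modnn index_head.
Qed.

Lemma mem_full_tuple n (c : n.-tuple 'I_n) i : uniq c -> i \in c.
Proof.
move=> c_uniq; have card_c : #|c| = #|'I_n|.
  by rewrite (card_uniqP c_uniq) size_tuple card_ord.
by rewrite (elimT (subset_cardP card_c) (subset_predT _)).
Qed.

Lemma index_full_tuple_lt n (c : n.-tuple 'I_n) i : uniq c ->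
  (index i c < n)%N.
Proof. by move/(mem_full_tuple i); rewrite -index_mem size_tuple. Qed.

(** This makes the minimum over the Hamiltonian circuits an attained one, rather
    than the default value of the minimization operator. *)
Lemma hamiltonian_ord_tuple n : (2 <= n)%N -> hamiltonian (ord_tuple n).
Proof.
move=> n_ge2; have c_uniq : uniq (ord_tuple n) by exact: enum_uniq.
rewrite /hamiltonian /ucycleb c_uniq andbT; apply: cycle_from_next => // i i_c.
apply/eqP=> /(congr1 (fun j => index j (ord_tuple n))).
have := i_c; rewrite -index_mem size_tuple index_next // size_tuple.
move: (index i _) => p; rewrite leq_eqVlt => /predU1P[p1_eq | p_lt].
  by rewrite p1_eq modnn; lia.
by rewrite modn_small //; lia.
Qed.

Definition cycle_dist_mx (R : realType) n (c : n.-tuple 'I_n) (k : nat) :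
    'M[R]_n :=
  \matrix_(i, j) (cycle_dist n (index i c) (index j c) == k)%:R.

(** The classes k = 1, ..., n/2 partition the off-diagonal entries, so a
    combination of the matrices reads off the coefficient of the distance. *)
Lemma sum_cycle_dist_mx (R : realType) n (c : n.-tuple 'I_n) (f : nat -> R)
    i j : uniq c ->
  (\sum_(1 <= k < (n./2).+1) f k *: cycle_dist_mx R c k) i j =
  if i == j then 0 else f (cycle_dist n (index i c) (index j c)).
Proof.
move=> c_uniq; have c_full k := mem_full_tuple k c_uniq.
have idx_lt k := index_full_tuple_lt k c_uniq.
have := cycle_dist_eq0 (idx_lt i) (idx_lt j).
rewrite (inj_in_eq (@index_inj _ i (tval c))) //.
have := cycle_dist_le_half n (index i c) (index j c).
rewrite summxE; under eq_bigr do rewrite !mxE.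
move: (cycle_dist _ _ _) => m m_le <-.
case: eqP => [-> | /eqP m_neq0].
  by rewrite big_nat_cond big1 // => k /andP[/andP[k_gt0 _] _];
     rewrite ltn_eqF ?mulr0.
rewrite (bigD1_seq m) ?iota_uniq ?mem_index_iota ?lt0n ?m_neq0 //=.
rewrite eqxx mulr1 big1 ?addr0 // => k k_neq.
by rewrite eq_sym (negbTE k_neq) mulr0.
Qed.

Lemma cycle_dist_mx_feasible (R : realType) n (c : n.-tuple 'I_n) : uniq c ->
  SDP_feasible (cycle_dist_mx R c).
Proof.
move=> c_uniq; have c_full k := mem_full_tuple k c_uniq.
have idx_lt k := index_full_tuple_lt k c_uniq.
split=> [k _ | k _ i j | | i _].
- by apply/matrixP=> i j; rewrite !mxE cycle_distC.
- by rewrite mxE ler0n.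
- have -> : \sum_(1 <= k < (n./2).+1) cycle_dist_mx R c k =
            \sum_(1 <= k < (n./2).+1) 1 *: cycle_dist_mx R c k.
    by apply: eq_bigr => k _; rewrite scale1r.
  apply/matrixP=> i j; rewrite (sum_cycle_dist_mx (fun=> 1)) // !mxE.
  by case: eqP => _; rewrite ?subrr ?subr0.
pose t a : R := 2 * pi * i%:R / n%:R * (index a c)%:R.
suff -> : 1%:M + \sum_(1 <= k < (n./2).+1)
            cos (2 * pi * i%:R * k%:R / n%:R) *: cycle_dist_mx R c k =
          \matrix_(a, b) cos (t a - t b) by exact: mx_psd_cos_sub.
apply/matrixP=> a b.
rewrite !mxE (sum_cycle_dist_mx (fun k => cos (2 * pi * i%:R * k%:R / n%:R))) //.
case: eqP => [-> | _]; first by rewrite subrr cos0 addr0.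
by rewrite add0r cos_cycle_dist.
Qed.

(** Every edge of the tour occurs twice in the adjacency matrix, once in each
    direction; the symmetry of D makes the two contributions equal. *)
Lemma trace_cycle_dist_mx1 (R : realType) n (D : 'M[R]_n) (c : n.-tuple 'I_n) :
    (3 <= n)%N -> (forall i j, D i j = D j i) -> uniq c ->
  2^-1 * \tr (D *m cycle_dist_mx R c 1) = circuit_length D c.
Proof.
move=> n_ge3 D_sym c_uniq; have c_full k := mem_full_tuple k c_uniq.
have idx_lt k := index_full_tuple_lt k c_uniq.
have idx_next k : index (next c k) c = ((index k c).+1 %% n)%N.
  by rewrite index_next // size_tuple.
have adjE i j : (cycle_dist n (index j c) (index i c) == 1%N)%:R =
    (j == next c i)%:R + (i == next c j)%:R :> R.
  rewrite cycle_distC cycle_dist_eq1 // natrD -!idx_next.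
  by rewrite !(inj_in_eq (@index_inj _ i (tval c))) ?mem_next.
have edgeE : \sum_i D i (next c i) = circuit_length D c.
  rewrite /circuit_length (big_uniq _ c_uniq).
  by apply: eq_bigl => i; rewrite c_full.
have rowE i : \sum_j D i j * (j == next c i)%:R = D i (next c i).
  rewrite (bigD1 (next c i)) //= eqxx mulr1 big1 ?addr0 // => j /negbTE ->.
  exact: mulr0.
suff -> : \tr (D *m cycle_dist_mx R c 1) =
          circuit_length D c + circuit_length D c by field.
rewrite /mxtrace; under eq_bigr => i _.
  rewrite mxE; under eq_bigr => j _ do rewrite mxE adjE mulrDr.
  rewrite big_split /= rowE; over.
rewrite big_split /= edgeE exchange_big /=; congr (_ + _).
rewrite -edgeE; apply: eq_bigr => j _; rewrite -rowE.
by apply: eq_bigr => i _; rewrite D_sym.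
Qed.

Theorem theorem1 (R : realType) (n : nat) (D : 'M[R]_n)
    (n_ge3 : (3 <= n)%N)
    (D_sym : forall i j, D i j = D j i)
    (D_pos : forall i j, i != j -> 0 < D i j) :
  (SDP_opt D <= (TSP_opt D)%:E)%E.
Proof.
rewrite /TSP_opt; case: arg_minP => [|c /andP[_ c_uniq] _].
  exact: hamiltonian_ord_tuple (ltnW n_ge3).
apply: ge_ereal_inf; exists (circuit_length D c)%:E => //.
exists (cycle_dist_mx R c); first exact: cycle_dist_mx_feasible.
by rewrite trace_cycle_dist_mx1.
Qed.
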